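(* Let $f:[0,\infty)\to\mathbb{R}$ be a uniformly convex function with modulus $\Phi:[0,\infty)\to[0,\infty)$, where $\Phi$ satisfies $\Phi(AB)\le\Phi(A)\Phi(B)$ for all $A>0$, $B>0$. Let $n>1$ be an integer, let $x_1,\dots,x_n$ be positive real numbers, and put $$a=\frac1n\sum_{i=1}^n x_i,\qquad d=\frac1n\sum_{i=1}^n f(x_i).$$ If $\Phi$ is convex, then $$\max_{1\le k\le n}\Phi\left(|x_k-a|\right)\ \le\ \frac{n\,\Phi(n-1)}{n-1+\Phi(n-1)}\,\big(d-f(a)\big).$$
   Context: A function $f:[0,\infty)\to\mathbb{R}$ is uniformly convex with modulus $\Phi:[0,\infty)\to[0,\infty)$ if for all $x,y\ge 0$ and $t\in[0,1]$, $$tf(x)+(1-t)f(y)\ \ge\ f\big(tx+(1-t)y\big)+t(1-t)\,\Phi\big(|x-y|\big).$$ *)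

(* Defs.v *)
From mathcomp Require Import all_boot all_order all_algebra.
From mathcomp Require Import all_classical all_reals all_analysis.

Set Implicit Arguments.
Unset Strict Implicit.
Unset Printing Implicit Defensive.

Import Order.TTheory GRing.Theory Num.Theory.

Local Open Scope ring_scope.

(* Functions on [0, +oo[ are represented by total functions R -> R whose values
   at negative arguments are never constrained nor used. *)

Definition uniformly_convex (R : realType) (f Phi : R -> R) : Prop :=
  forall x y t : R, 0 <= x -> 0 <= y -> 0 <= t <= 1 ->
    f (t * x + (1 - t) * y) + t * (1 - t) * Phi `|x - y|
      <= t * f x + (1 - t) * f y.

(* Main.v *)
Require Import Defs.
From mathcomp Require Import all_boot all_order all_algebra.
From mathcomp Require Import all_classical all_reals all_analysis.
From mathcomp Require Import ring lra.

Import Order.TTheory GRing.Theory Num.Theory.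

Local Open Scope classical_set_scope.
Local Open Scope ring_scope.

(** Write u_i = |x_i - a|.  The proof combines three facts.

    First, a strong Jensen inequality: the mean of the Phi(u_i) is at most
    d - f(a) ([uniformly_convex_jensen]).  The usual proof compares f with a
    supporting line at a; here the line is replaced by contracting the points
    x_i towards a.  For 0 < t < 1 uniform convexity gives
      f(t x_i + (1 - t) a) + t (1 - t) Phi(u_i) <= t f(x_i) + (1 - t) f(a),
    and the contracted points still have mean a, so averaging, bounding the
    mean of the first terms below by f(a) (plain Jensen), and dividing by t,
    yields (1 - t) mean(Phi(u_i)) <= d - f(a); then t tends to 0.

    Secondly, Phi is nondecreasing: uniform convexity with x = y forces
    Phi(0) = 0, and a nonnegative convex function vanishing at 0 is
    nondecreasing.

    Thirdly, the deviations x_i - a add up to 0, so u_k is at most the sum of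
    the other n - 1 of the u_i; by Jensen for Phi and monotonicity these
    contribute at least (n - 1) Phi(u_k / (n - 1)) ([sum_convex_ge]).

    Altogether Phi(u_k) + (n - 1) Phi(u_k / (n - 1)) <= n (d - f(a)).
    Multiplying by Phi(n - 1), and using
    Phi(u_k) <= Phi(n - 1) Phi(u_k / (n - 1)), gives
    (n - 1 + Phi(n - 1)) Phi(u_k) <= n Phi(n - 1) (d - f(a)). *)

(** * Convex functions on the half-line *)

(** [convex_function] on [0, +oo[ with the weight a plain real number, so that
    arithmetic tactics apply to it. *)
Definition convex_nneg {R : realType} (g : R -> R) : Prop :=
  forall x y t : R, 0 <= x -> 0 <= y -> 0 <= t <= 1 ->
    g (t * x + (1 - t) * y) <= t * g x + (1 - t) * g y.

Lemma convex_function_nneg {R : realType} (g : R -> R) :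
  @convex_function R R^o `[0, +oo[ g -> convex_nneg g.
Proof.
move=> cvx_g x y t x_ge0 y_ge0 /andP[t_ge0 t_le1].
have nneg_in (z : R) : 0 <= z -> z \in [set` `[0, +oo[].
  by move=> z_ge0; rewrite inE /= in_itv /= z_ge0.
have t01 : Itv.spec (@Itv.num_sem R) (Itv.Real `[0%Z, 1%Z]) t.
  by rewrite /Itv.spec /Itv.num_sem /= in_itv /= t_ge0 t_le1 ger0_real.
exact: (cvx_g (Itv.mk t01) x y (nneg_in x x_ge0) (nneg_in y y_ge0)).
Qed.

(** Jensen's inequality for equal weights.  Indexing by a list makes the
    induction immediate and allows one index to be dropped from a family. *)
Lemma convex_nneg_jensen {R : realType} (g : R -> R) {I : Type} (r : seq I)
    (y : I -> R) :
  convex_nneg g -> (forall i, 0 <= y i) -> (0 < size r)%N ->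
  (size r)%:R * g ((size r)%:R^-1 * \sum_(i <- r) y i)
    <= \sum_(i <- r) g (y i).
Proof.
move=> cvx_g y_ge0; elim: r => [//|i [|j r] IHr] _.
  by rewrite !big_seq1 /= invr1 !mul1r.
rewrite 2![\sum_(_ <- i :: _) _]big_cons.
move: IHr => /(_ isT); set s := j :: r; set m : R := (size s)%:R.
have m_gt0 : 0 < m by rewrite ltr0n.
have -> : (size (i :: s))%:R = 1 + m :> R by rewrite /= -natr1 addrC.
set S := \sum_(i <- s) y i => IHr.
have S_ge0 : 0 <= S by rewrite sumr_ge0.
have m1_gt0 : 0 < 1 + m by lra.
(* the mean over i :: s is the mixture of y i and of the mean over s with
   weights 1 / (1 + m) and m / (1 + m) *)
have t01 : 0 <= (1 + m)^-1 <= 1.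
  by rewrite invr_ge0 (ltW m1_gt0) invf_le1 //; lra.
have mean_ge0 : 0 <= m^-1 * S by rewrite mulr_ge0 // invr_ge0 ltW.
have := cvx_g (y i) (m^-1 * S) (1 + m)^-1 (y_ge0 i) mean_ge0 t01.
have -> : (1 + m)^-1 * y i + (1 - (1 + m)^-1) * (m^-1 * S)
          = (1 + m)^-1 * (y i + S).
  by field; rewrite !gt_eqF.
rewrite -(ler_pM2l m1_gt0) => /le_trans; apply.
have -> : (1 + m) * ((1 + m)^-1 * g (y i)
            + (1 - (1 + m)^-1) * g (m^-1 * S)) = g (y i) + m * g (m^-1 * S).
  by field; rewrite gt_eqF.
by rewrite lerD2l.
Qed.

(** For u <= v the point u lies on the segment from 0 to v, so g u is at most
    (u / v) g v. *)
Lemma convex_nneg_nondecreasing {R : realType} (g : R -> R) :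
  convex_nneg g -> g 0 = 0 -> (forall u : R, 0 <= u -> 0 <= g u) ->
  forall u v : R, 0 <= u -> u <= v -> g u <= g v.
Proof.
move=> cvx_g g0 g_ge0 u v u_ge0 uv.
have [v0|v_gt0] := leP v 0.
  by have -> : u = v by lra.
have t01 : 0 <= u / v <= 1.
  by rewrite divr_ge0 ?(ltW v_gt0) //= ler_pdivrMr // mul1r.
have := cvx_g v 0 (u / v) (ltW v_gt0) (lexx 0) t01.
rewrite g0 !mulr0 !addr0 divfK ?gt_eqF // => /le_trans; apply.
by case/andP: t01 => _ t_le1; rewrite ler_piMl // g_ge0 // ltW.
Qed.

(** * Uniformly convex functions *)

Lemma uniformly_convex_modulus0 {R : realType} (f Phi : R -> R) :
  (forall u : R, 0 <= u -> 0 <= Phi u) -> uniformly_convex f Phi -> Phi 0 = 0.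
Proof.
move=> Phi_ge0 uf; apply/eqP; rewrite eq_le Phi_ge0 // andbT.
have half01 : 0 <= (2^-1 : R) <= 1 by apply/andP; split; lra.
have := uf 0 0 2^-1 (lexx _) (lexx _) half01.
by rewrite subrr normr0 !mulr0 addr0; lra.
Qed.

Lemma uniformly_convex_nneg {R : realType} (f Phi : R -> R) :
  (forall u : R, 0 <= u -> 0 <= Phi u) -> uniformly_convex f Phi ->
  convex_nneg f.
Proof.
move=> Phi_ge0 uf x y t x_ge0 y_ge0 t01.
apply: le_trans (uf x y t x_ge0 y_ge0 t01); rewrite lerDl.
by case/andP: t01 => t_ge0 t_le1; rewrite !mulr_ge0 ?subr_ge0 ?Phi_ge0.
Qed.

(** Lets a parameter t tend to 0 without any topology. *)
Lemma ler_of_contractions {R : realType} (m c : R) :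
  0 <= m -> (forall t : R, 0 < t < 1 -> (1 - t) * m <= c) -> m <= c.
Proof.
move=> m_ge0 le_c; rewrite leNgt; apply/negP => c_lt_m.
have half01 : 0 < (2^-1 : R) < 1 by apply/andP; split; lra.
have c_ge0 : 0 <= c by have := le_c _ half01; lra.
have m_gt0 : 0 < m by lra.
(* for this t, (1 - t) m is the midpoint of c and m, which exceeds c *)
have t01 : 0 < (m - c) / (2 * m) < 1.
  by apply/andP; split; [rewrite divr_gt0|rewrite ltr_pdivrMr]; lra.
have := le_c _ t01.
have -> : (1 - (m - c) / (2 * m)) * m = (m + c) / 2 by field; rewrite gt_eqF.
lra.
Qed.

(** Pulling the points towards their mean by a factor t keeps the mean, and
    costs t (1 - t) Phi at each point; plain Jensen for the pulled points then
    turns that cost into a lower bound for the Jensen gap of the x_i. *)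
Lemma uniformly_convex_jensen {R : realType} (f Phi : R -> R) {n : nat}
    (x : 'I_n -> R) :
  (forall u : R, 0 <= u -> 0 <= Phi u) -> uniformly_convex f Phi ->
  (0 < n)%N -> (forall i, 0 <= x i) ->
  let a := n%:R^-1 * \sum_(i < n) x i in
  \sum_(i < n) Phi `|x i - a| <= \sum_(i < n) f (x i) - n%:R * f a.
Proof.
move=> Phi_ge0 uf n_gt0 x_ge0; set a := n%:R^-1 * _; rewrite /=.
have nR_gt0 : 0 < n%:R :> R by rewrite ltr0n.
have a_ge0 : 0 <= a by rewrite mulr_ge0 ?invr_ge0 ?sumr_ge0 // ltW.
have sum_x : \sum_(i < n) x i = n%:R * a by rewrite mulVKf // gt_eqF.
apply: ler_of_contractions => [|t /andP[t_gt0 t_lt1]].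
  by apply: sumr_ge0 => i _; apply: Phi_ge0.
have t01 : 0 <= t <= 1 by rewrite !ltW.
set P := \sum_(i < n) _.
pose z i := t * x i + (1 - t) * a.
have z_ge0 i : 0 <= z i by rewrite addr_ge0 // mulr_ge0 ?subr_ge0 // ltW.
have size_n : size (index_enum 'I_n) = n.
  by rewrite -sum1_size sum1_card card_ord.
have mean_z : n%:R^-1 * \sum_(i < n) z i = a.
  rewrite big_split /= -mulr_sumr sum_x sumr_const card_ord.
  by rewrite -mulr_natl; field; rewrite gt_eqF.
have jensen_z : n%:R * f a <= \sum_(i < n) f (z i).
  have := convex_nneg_jensen f (index_enum 'I_n) z
    (uniformly_convex_nneg f Phi Phi_ge0 uf) z_ge0.
  by rewrite size_n mean_z; apply.
have : \sum_(i < n) (f (z i) + t * (1 - t) * Phi `|x i - a|)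
    <= \sum_(i < n) (t * f (x i) + (1 - t) * f a).
  by apply: ler_sum => i _; apply: uf.
rewrite !big_split /= -!mulr_sumr -/P sumr_const card_ord -mulr_natl.
move=> sum_uf; rewrite -(ler_pM2l t_gt0); lra.
Qed.

(** * Deviations from the mean *)

(** When the w_i add up to 0, |w_k| is at most the sum of the other |w_i|, so
    those n - 1 values have mean at least |w_k| / (n - 1). *)
Lemma sum_convex_ge {R : realType} (g : R -> R) {n : nat} (w : 'I_n -> R)
    (k : 'I_n) :
  convex_nneg g -> (forall u v : R, 0 <= u -> u <= v -> g u <= g v) ->
  (1 < n)%N -> \sum_(i < n) w i = 0 ->
  g `|w k| + (n%:R - 1) * g ((n%:R - 1)^-1 * `|w k|)
    <= \sum_(i < n) g `|w i|.
Proof.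
move=> cvx_g mono_g n_gt1 sum_w.
rewrite [leRHS](bigD1 k) //= lerD2l.
pose r := [seq i <- index_enum 'I_n | i != k].
have size_r : (size r)%:R = n%:R - 1 :> R.
  have -> : size r = n.-1.
    rewrite size_filter -sum1_count sum1_card.
    by rewrite cardC1 card_ord.
  by rewrite -{2}(prednK (ltnW n_gt1)) -natr1 addrK.
have n1_gt0 : 0 < n%:R - 1 :> R by rewrite subr_gt0 ltr1n.
have r_gt0 : (0 < size r)%N by rewrite -(ltr0n R) size_r.
have := convex_nneg_jensen g r (fun i => `|w i|) cvx_g
  (fun i => normr_ge0 _) r_gt0.
rewrite size_r !big_filter; apply: le_trans.
rewrite ler_pM2l //; apply: mono_g.
  by rewrite mulr_ge0 // invr_ge0 ltW.
rewrite ler_pM2l ?invr_gt0 //.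
have -> : w k = - \sum_(i < n | i != k) w i.
  by apply/eqP; rewrite -addr_eq0; move: sum_w; rewrite (bigD1 k) //= => ->.
by rewrite normrN ler_norm_sum.
Qed.

Theorem theorem13 (R : realType) (f Phi : R -> R)
    (Phi_ge0 : forall u : R, 0 <= u -> 0 <= Phi u)
    (f_uconvex : uniformly_convex f Phi)
    (Phi_submul : forall A B : R, 0 < A -> 0 < B ->
       Phi (A * B) <= Phi A * Phi B)
    (n : nat) (n_gt1 : (1 < n)%N)
    (x : 'I_n -> R) (x_gt0 : forall i : 'I_n, 0 < x i)
    (Phi_convex : @convex_function R R^o `[0, +oo[ Phi) :
  let a := n%:R^-1 * \sum_(i < n) x i in
  let d := n%:R^-1 * \sum_(i < n) f (x i) in
  \big[Num.max/0]_(k < n) Phi `|x k - a|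
    <= n%:R * Phi (n%:R - 1) / (n%:R - 1 + Phi (n%:R - 1)) * (d - f a).
Proof.
set a := n%:R^-1 * _; set d := n%:R^-1 * _; rewrite /=.
have nR_gt0 : 0 < n%:R :> R by rewrite ltr0n ltnW.
have N_gt0 : 0 < n%:R - 1 :> R by rewrite subr_gt0 ltr1n.
have PhiN_ge0 := Phi_ge0 _ (ltW N_gt0).
have Phi0 := uniformly_convex_modulus0 f Phi Phi_ge0 f_uconvex.
have cvx_Phi := convex_function_nneg Phi Phi_convex.
have mono_Phi := convex_nneg_nondecreasing Phi cvx_Phi Phi0 Phi_ge0.
have gap : \sum_(i < n) Phi `|x i - a| <= n%:R * (d - f a).
  rewrite mulrBr mulVKf ?gt_eqF //.
  by apply: uniformly_convex_jensen (ltnW n_gt1) _ => // i; apply: ltW.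
have gap_ge0 : 0 <= n%:R * (d - f a).
  by apply: le_trans gap; apply: sumr_ge0 => i _; apply: Phi_ge0.
have sum_dev : \sum_(i < n) (x i - a) = 0.
  rewrite big_split /= sumr_const card_ord -mulr_natl mulrN mulVKf ?subrr //.
  by rewrite gt_eqF.
have den_gt0 : 0 < n%:R - 1 + Phi (n%:R - 1) by rewrite ltr_pwDl.
have -> : n%:R * Phi (n%:R - 1) / (n%:R - 1 + Phi (n%:R - 1)) * (d - f a)
    = Phi (n%:R - 1) * (n%:R * (d - f a)) / (n%:R - 1 + Phi (n%:R - 1)).
  by field; rewrite gt_eqF.
apply: bigmax_le => [|k _].
  by rewrite divr_ge0 ?(ltW den_gt0) // mulr_ge0.
rewrite ler_pdivlMr //.
have := sum_convex_ge Phi (fun i => x i - a) k cvx_Phi mono_Phi n_gt1 sum_dev.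
move=> /le_trans /(_ gap) /=.
set u := `|x k - a|; set v := (n%:R - 1)^-1 * u => dev_le.
(* submultiplicativity is only available for u > 0; at u = 0 both sides
   vanish *)
have submul : Phi u <= Phi (n%:R - 1) * Phi v.
  have [u0|u_gt0] := leP u 0.
    have u_eq0 : u = 0 by apply/eqP; rewrite eq_le u0 normr_ge0.
    by rewrite /v u_eq0 mulr0 Phi0 mulr0.
  have {1}-> : u = (n%:R - 1) * v by rewrite mulVKf // gt_eqF.
  by rewrite Phi_submul // mulr_gt0 // invr_gt0.
apply: le_trans (ler_wpM2l PhiN_ge0 dev_le).
have := ler_wpM2l (ltW N_gt0) submul; lra.
Qed.
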